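(* Suppose that $(A,M)$ is a self-dual Schur pair such that $A$ is a symmetric algebra and $A$ is a direct summand of $M$ (as a right $A$-module), and let $e\colon M\to A$ be the natural projection map, viewed as an idempotent of $S=\mathrm{End}_A(M)$. Assume that $e^*=e$ and that $(D^\mu)^*\cong D^\mu$ for all $\mu\in\mathcal K$. Let $\lambda\in\mathscr P$. Then the following are equivalent: (a) $\lambda\in\mathcal K$; (b) $D^\lambda\ne0$; (c) $L^\lambda$ is (isomorphic to) a right $S$-submodule of $M_R$; (d) $P^\lambda$ is (isomorphic to) a direct summand of $M_R$ as a right $S$-module; (e) $P^\lambda$ is a projective-injective right $S$-module; (f) $P^\lambda$ is self-dual.
   Context: $K$ is a field; all algebras and modules are finite dimensional over $K$. A Schur pair is a pair $(A,M)$ where $A$ is a self-injective finite dimensional $K$-algebra and $M$ is a faithful finite dimensional right $A$-module; $S=S_A(M)=\mathrm{End}_A(M)$, acting on $M$ from the left. It is assumed that $A$ and $S$ are split over $K$. $A$ is symmetric if it has a non-degenerate symmetric bilinear form with $\langle xa,y\rangle=\langle x,ay\rangle$ for all $a,x,y\in A$. If $A$ has an anti-involution $*$, the dual of a right $A$-module $X$ is $X^*=\mathrm{Hom}_K(X,K)$ with $(fa)(x)=f(xa^* )$. The Schur pair is self-dual if $A$ is equipped with an anti-involution $*$ such that $M\cong M^*$ as $A$-modules; fix such an isomorphism $\theta\colon M\to M^*$. It induces an anti-isomorphism $s\mapsto s^*$ of $S$ by $s^*=\theta^{-1}\circ s^\tau\circ\theta$, where $s^\tau(f)=f\circ s$ for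 $f\in M^*$. The dual of a right $S$-module $X$ is $X^*=\mathrm{Hom}_K(X,K)$ with $(fs)(x)=f(xs^* )$, and $X$ is self-dual if $X\cong X^*$. $M_R$ is the $(A,S)$-bimodule equal to $M$ as a vector space with $a\cdot x\cdot s=s^*xa^*$ for $a\in A$, $x\in M$, $s\in S$. Let $\{L^\lambda:\lambda\in\mathscr P\}$ be a complete set of pairwise non-isomorphic simple right $S$-modules and $P^\lambda$ the projective cover of $L^\lambda$. Let $\mathsf F(X)=X\otimes_SM$ (a right $A$-module via $(x\otimes m)a=x\otimes ma$) for a right $S$-module $X$; put $D^\lambda=\mathsf F(L^\lambda)$ and $\mathcal K=\{\lambda\in\mathscr P:D^\lambda\ne0\}$. *)

(* Defs.v *)
From HB Require Import structures.
From mathcomp Require Import all_boot all_algebra all_field.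

Set Implicit Arguments.
Unset Strict Implicit.
Unset Printing Implicit Defensive.

Import GRing.Theory.
Local Open Scope ring_scope.

Section LinearFacts.

Variables (K : fieldType) (V W : vectType K) (f : V -> W).
Hypothesis f_linear : linear f.

Lemma linfun_linearE : linfun f =1 f.
Proof.
pose h := GRing.isLinear.Build K V W *:%R f f_linear.
pose F : {linear V -> W} := HB.pack f h.
exact: (lfunE F).
Qed.

Lemma linear_basis_sum x :
  f x = \sum_i coord (vbasis {:V}) i x *: f (vbasis {:V})`_i.
Proof.
rewrite -linfun_linearE {1}(coord_vbasis (memvf x)) linear_sum.
by apply: eq_bigr => i _; rewrite linearZ /= linfun_linearE.
Qed.

Lemma linear_basis_mem (U : {vspace W}) x :
  (forall v, v \in vbasis {:V} -> f v \in U) -> f x \in U.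
Proof.
move=> fU; rewrite linear_basis_sum memv_suml // => i _.
by rewrite memvZ // fU // mem_nth // size_tuple.
Qed.

End LinearFacts.

Section Modules.

Variables (K : fieldType) (B : falgType K).

(* A finite dimensional right B-module; [ract x b] is x b. *)
Record rmodule := RModule {
  rmod_sort :> vectType K;
  ract : rmod_sort -> B -> rmod_sort;
  ract_linearl : forall b, linear (ract^~ b);
  ract_linearr : forall x, linear (ract x);
  ract1 : forall x, ract x 1 = x;
  ractM : forall x b c, ract x (b * c) = ract (ract x b) c
}.

Record rhom (X Y : rmodule) := RHom {
  rhom_lfun :> 'Hom(X, Y);
  rhomP : forall x b, rhom_lfun (ract x b) = ract (rhom_lfun x) b
}.

Record riso (X Y : rmodule) := RIso {
  riso_hom :> rhom X Y;
  riso_bij : bijective riso_hom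
}.

Definition isomorphic (X Y : rmodule) : Prop := inhabited (riso X Y).

Definition surj (X Y : rmodule) (f : rhom X Y) : Prop :=
  forall y, exists x, f x = y.

Definition nonzero (X : rmodule) : Prop := exists x : X, x != 0.

Record rsub (X : rmodule) := RSub {
  rsub_space :> {vspace X};
  rsubP : forall x b, x \in rsub_space -> ract x b \in rsub_space
}.

Section SubModule.

Variables (X : rmodule) (U : rsub X).

Definition sub_ract (x : subvs_of U) (b : B) : subvs_of U :=
  Subvs (rsubP b (subvsP x)).

Fact sub_ract_linearl b : linear (sub_ract^~ b).
Proof. by move=> k x y; apply/val_inj; rewrite /= ract_linearl. Qed.

Fact sub_ract_linearr x : linear (sub_ract x).
Proof. by move=> k b c; apply/val_inj; rewrite /= ract_linearr. Qed.

Fact sub_ract1 x : sub_ract x 1 = x.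
Proof. by apply/val_inj; rewrite /= ract1. Qed.

Fact sub_ractM x b c : sub_ract x (b * c) = sub_ract (sub_ract x b) c.
Proof. by apply/val_inj; rewrite /= ractM. Qed.

Definition submodule : rmodule :=
  RModule sub_ract_linearl sub_ract_linearr sub_ract1 sub_ractM.

End SubModule.

Definition internal_sum (X : rmodule) (U V : rsub X) : Prop :=
  (U + V = fullv)%VS /\ (U :&: V = 0)%VS.

Definition isom_submodule (X Y : rmodule) : Prop :=
  exists U : rsub Y, isomorphic X (submodule U).

Definition isom_summand (X Y : rmodule) : Prop :=
  exists U V : rsub Y, internal_sum U V /\ isomorphic X (submodule U).

Definition simple_mod (X : rmodule) : Prop :=
  nonzero X /\
  forall U : rsub X, (U : {vspace X}) = 0%VS \/ (U : {vspace X}) = fullv.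

Definition projective_mod (P : rmodule) : Prop :=
  forall (X Y : rmodule) (p : rhom X Y) (f : rhom P Y), surj p ->
  exists g : rhom P X, forall x, p (g x) = f x.

Definition injective_mod (I : rmodule) : Prop :=
  forall (X Y : rmodule) (i : rhom X Y) (f : rhom X I), injective i ->
  exists g : rhom Y I, forall x, g (i x) = f x.

Definition projective_cover (P L : rmodule) : Prop :=
  projective_mod P /\
  exists p : rhom P L, surj p /\
    forall U : rsub P, (U + lker p = fullv)%VS -> (U : {vspace P}) = fullv.

Definition faithful_mod (X : rmodule) : Prop :=
  forall b : B, (forall x : X, ract x b = 0) -> b = 0.

Definition reg_ract (x b : B) : B := x * b.

Fact reg_ract_linearl b : linear (reg_ract^~ b).
Proof. by move=> k x y; rewrite /reg_ract mulrDl scalerAl. Qed.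

Fact reg_ract_linearr x : linear (reg_ract x).
Proof. by move=> k b c; rewrite /reg_ract mulrDr scalerAr. Qed.

Definition regular_mod : rmodule :=
  RModule reg_ract_linearl reg_ract_linearr (@mulr1 B) (@mulrA B).

Definition self_injective : Prop := injective_mod regular_mod.

Definition split_alg : Prop :=
  forall L : rmodule, simple_mod L ->
  forall f : rhom L L, exists k : K, forall x, f x = k *: x.

Definition symmetric_alg : Prop :=
  exists form : B -> B -> K,
    [/\ forall x, scalar (form x),
        forall y, scalar (form^~ y),
        forall x y, form x y = form y x,
        forall x, (forall y, form x y = 0) -> x = 0
      & forall a x y, form (x * a) y = form x (a * y)].

Definition complete_simples (I : Type) (L : I -> rmodule) : Prop :=
  [/\ forall i, simple_mod (L i),
      forall i j, isomorphic (L i) (L j) -> i = j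
    & forall X, simple_mod X -> exists i, isomorphic X (L i)].

Definition rmul (X : rmodule) (b : B) : 'End(X) := linfun (@ract X ^~ b).

Lemma rmulE (X : rmodule) (b : B) (x : X) : rmul X b x = ract x b.
Proof. exact/linfun_linearE/ract_linearl. Qed.

Record anti_hom := AntiHom {
  anti_fun :> B -> B;
  anti_linear : linear anti_fun;
  anti1 : anti_fun 1 = 1;
  antiM : forall x y, anti_fun (x * y) = anti_fun y * anti_fun x
}.

Record anti_involution := AntiInvolution {
  anti_inv_hom :> anti_hom;
  anti_invK : involutive anti_inv_hom
}.

Section Dual.

Variables (sigma : anti_hom) (X : rmodule).

Definition dual_ract (f : 'Hom(X, K^o)) (b : B) : 'Hom(X, K^o) :=
  (f \o rmul X (sigma b))%VF.

Lemma dual_ractE f b x : dual_ract f b x = f (ract x (sigma b)).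
Proof. by rewrite comp_lfunE rmulE. Qed.

Fact dual_ract_linearl b : linear (dual_ract^~ b).
Proof.
move=> k f g; apply/lfunP=> x.
by rewrite !(add_lfunE, scale_lfunE, dual_ractE).
Qed.

Fact dual_ract_linearr f : linear (dual_ract f).
Proof.
move=> k b c; apply/lfunP=> x.
rewrite !(add_lfunE, scale_lfunE, dual_ractE).
by rewrite anti_linear ract_linearr linearP.
Qed.

Fact dual_ract1 f : dual_ract f 1 = f.
Proof. by apply/lfunP=> x; rewrite dual_ractE anti1 ract1. Qed.

Fact dual_ractM f b c : dual_ract f (b * c) = dual_ract (dual_ract f b) c.
Proof. by apply/lfunP=> x; rewrite !dual_ractE antiM ractM. Qed.

Definition dual_mod : rmodule :=
  RModule dual_ract_linearl dual_ract_linearr dual_ract1 dual_ractM.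

End Dual.

End Modules.

Arguments regular_mod {K} B.
Arguments self_injective {K} B.
Arguments split_alg {K} B.
Arguments symmetric_alg {K} B.

Record schur_pair (K : fieldType) := SchurPair {
  spA : falgType K;
  spM : rmodule spA;
  spA_self_injective : self_injective spA;
  spM_faithful : faithful_mod spM
}.

Section SchurAlgebra.

Variables (K : fieldType) (AM : schur_pair K).
Local Notation A := (spA AM).
Local Notation M := (spM AM).

(* The maps commuting with the action of a basis of A, hence with A. *)
Definition endv : {vspace 'End(M)} :=
  (\bigcap_(a <- vbasis {:A})
     lker (linfun (fun f : 'End(M) => (f \o rmul M a) - (rmul M a \o f))%VF))%VS.

Let comm a (f : 'End(M)) : 'End(M) := ((f \o rmul M a) - (rmul M a \o f))%VF.

Fact comm_linear a : linear (comm a).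
Proof.
move=> k f g; rewrite /comm comp_lfunDl comp_lfunDr -comp_lfunZl -comp_lfunZr.
by rewrite scalerBr opprD addrACA.
Qed.

Fact mem_lker_comm a f :
  (f \in lker (linfun (comm a))) = (f \o rmul M a == rmul M a \o f)%VF.
Proof.
by rewrite memv_ker (linfun_linearE (@comm_linear a)) subr_eq0.
Qed.

Lemma endvP (f : 'End(M)) :
  reflect (forall x a, f (ract x a) = ract (f x) a) (f \in endv).
Proof.
have -> : (f \in endv) =
    all (fun a => (f \o rmul M a == rmul M a \o f)%VF) (vbasis {:A}).
  rewrite /endv; elim: (tval _) => [|a s IHs]; first by rewrite big_nil memvf.
  by rewrite big_cons memv_cap IHs /= mem_lker_comm.
apply: (iffP allP) => [fC x a | fC a _]; last first.
  by apply/eqP/lfunP=> x; rewrite !comp_lfunE !rmulE.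
rewrite (linear_basis_sum (ract_linearr x)) [RHS](linear_basis_sum (ract_linearr _)).
rewrite linear_sum; apply: eq_bigr => i _; rewrite linearZ /=; congr (_ *: _).
have bi : (vbasis {:A})`_i \in vbasis {:A} by rewrite mem_nth ?size_tuple.
by have /eqP/lfunP/(_ x) := fC _ bi; rewrite !comp_lfunE !rmulE.
Qed.

(* S = End_A(M).  The alias keeps the product below separate from the one    *)
(* MathComp puts on subspaces of an F-algebra.                               *)
Definition schur_alg : predArgType := subvs_of endv.

HB.instance Definition _ := Vector.on schur_alg.

Definition sact (s : schur_alg) (x : M) : M := vsval s x.

Lemma sact_ract s x a : sact s (ract x a) = ract (sact s x) a.
Proof. exact: (endvP _ (subvsP s)). Qed.

Lemma sact_linearl x : linear (sact^~ x).
Proof. by move=> k s t; rewrite /sact linearP add_lfunE scale_lfunE. Qed.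

Lemma sact_linearr s : linear (sact s).
Proof. by move=> k x y; rewrite /sact linearP. Qed.

Fact schur_mul_subproof (s t : schur_alg) : (vsval s \o vsval t)%VF \in endv.
Proof.
by apply/endvP=> x a; rewrite !comp_lfunE; rewrite -!/(sact _ _) !sact_ract.
Qed.

Definition schur_mul (s t : schur_alg) : schur_alg :=
  Subvs (schur_mul_subproof s t).

Fact schur_one_subproof : \1%VF \in endv.
Proof. by apply/endvP=> x a; rewrite !id_lfunE. Qed.

Definition schur_one : schur_alg := Subvs schur_one_subproof.

Fact schur_mulA : associative schur_mul.
Proof. by move=> s t u; apply/val_inj; rewrite /= comp_lfunA. Qed.
Fact schur_mul1l : left_id schur_one schur_mul.
Proof. by move=> s; apply/val_inj; rewrite /= comp_lfun1l. Qed.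
Fact schur_mul1r : right_id schur_one schur_mul.
Proof. by move=> s; apply/val_inj; rewrite /= comp_lfun1r. Qed.
Fact schur_mulDl : left_distributive schur_mul +%R.
Proof. by move=> s t u; apply/val_inj; rewrite /= comp_lfunDl. Qed.
Fact schur_mulDr : right_distributive schur_mul +%R.
Proof. by move=> s t u; apply/val_inj; rewrite /= comp_lfunDr. Qed.
Fact schur_one_neq0 : schur_one != 0.
Proof.
apply/eqP=> /(congr1 val) /= /lfunP M0.
have /eqP := oner_neq0 A; apply; apply: (@spM_faithful _ AM) => x.
by rewrite ract1; have := M0 x; rewrite !lfunE.
Qed.

HB.instance Definition _ := GRing.Zmodule_isNzRing.Build schur_alg
  schur_mulA schur_mul1l schur_mul1r schur_mulDl schur_mulDr schur_one_neq0.

Fact schur_scaleAl k (s t : schur_alg) : k *: (s * t) = (k *: s) * t.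
Proof. by apply/val_inj; rewrite /= comp_lfunZl. Qed.
HB.instance Definition _ :=
  GRing.Lmodule_isLalgebra.Build K schur_alg schur_scaleAl.

Fact schur_scaleAr k (s t : schur_alg) : k *: (s * t) = s * (k *: t).
Proof. by apply/val_inj; rewrite /= comp_lfunZr. Qed.
HB.instance Definition _ :=
  GRing.Lalgebra_isAlgebra.Build K schur_alg schur_scaleAr.

HB.instance Definition _ := Algebra_isFalgebra.Build K schur_alg.

Lemma sact1 x : sact 1 x = x.
Proof. exact: id_lfunE. Qed.

Lemma sactM s t x : sact (s * t) x = sact s (sact t x).
Proof. exact: comp_lfunE. Qed.

End SchurAlgebra.

Section SchurStar.

Variables (K : fieldType) (AM : schur_pair K).
Local Notation A := (spA AM).
Local Notation M := (spM AM).
Local Notation S := (schur_alg AM).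

Variables (star : anti_involution A) (theta : riso M (dual_mod star M)).

Definition transpose (s : S) (f : 'Hom(M, K^o)) : 'Hom(M, K^o) :=
  (f \o vsval s)%VF.

Definition schur_star_lfun (s : S) : 'End(M) :=
  linfun (fun x => (theta^-1)%VF (transpose s (theta x))).

Let theta_ker : lker theta == 0%VS.
Proof. by apply/lker0P/bij_inj/riso_bij. Qed.

Let thetaK : cancel theta (theta^-1)%VF.
Proof. exact: lker0_lfunK. Qed.

Let thetaVK : cancel (theta^-1)%VF theta.
Proof. by have [g gK Kg] := riso_bij theta => f; rewrite -[f]Kg thetaK. Qed.

Lemma schur_star_lfunE s x :
  theta (schur_star_lfun s x) = transpose s (theta x).
Proof.
rewrite /schur_star_lfun linfun_linearE ?thetaVK // => k y z.
by rewrite /transpose linearP comp_lfunDl -comp_lfunZl linearP.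
Qed.

Fact schur_star_subproof s : schur_star_lfun s \in endv AM.
Proof.
apply/endvP=> x a; apply: (can_inj thetaK).
rewrite rhomP !schur_star_lfunE rhomP; apply/lfunP=> y.
rewrite /transpose comp_lfunE !dual_ractE comp_lfunE.
by rewrite -!/(sact _ _) sact_ract.
Qed.

Definition schur_star_fun (s : S) : S := Subvs (schur_star_subproof s).

(* With <x, y> = theta x y, this says <s^* x, y> = <x, s y>. *)
Lemma schur_starE s x y :
  theta (sact (schur_star_fun s) x) y = theta x (sact s y).
Proof. by rewrite [sact _ x]/= /sact /= schur_star_lfunE comp_lfunE. Qed.

Let schur_star_eq s t :
  (forall x y, theta (sact s x) y = theta (sact t x) y) -> s = t.
Proof.
move=> st; apply/val_inj/lfunP=> x; apply: (can_inj thetaK).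
by apply/lfunP=> y; apply: st.
Qed.

Fact schur_star_linear : linear schur_star_fun.
Proof.
move=> k s t; apply: schur_star_eq => x y.
rewrite schur_starE !sact_linearl !linearP add_lfunE scale_lfunE.
by rewrite !schur_starE.
Qed.

Fact schur_star1 : schur_star_fun 1 = 1.
Proof. by apply: schur_star_eq => x y; rewrite schur_starE !sact1. Qed.

Fact schur_starM s t :
  schur_star_fun (s * t) = schur_star_fun t * schur_star_fun s.
Proof. by apply: schur_star_eq => x y; rewrite !(sactM, schur_starE). Qed.

Definition schur_star : anti_hom S :=
  AntiHom schur_star_linear schur_star1 schur_starM.

Definition MR_ract (x : M) (s : S) : M := sact (schur_star s) x.

Fact MR_ract_linearl s : linear (MR_ract^~ s).
Proof. exact: sact_linearr. Qed.

Fact MR_ract_linearr x : linear (MR_ract x).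
Proof. by move=> k s t; rewrite /MR_ract anti_linear sact_linearl. Qed.

Fact MR_ract1 x : MR_ract x 1 = x.
Proof. by rewrite /MR_ract anti1 sact1. Qed.

Fact MR_ractM x s t : MR_ract x (s * t) = MR_ract (MR_ract x s) t.
Proof. by rewrite /MR_ract antiM sactM. Qed.

(* M_R as a right S-module.  Its left A-action a . x = x a^* is not needed.  *)
Definition MR_mod : rmodule S :=
  RModule MR_ract_linearl MR_ract_linearr MR_ract1 MR_ractM.

End SchurStar.

(* The quotient of V by W, realized on a complement of W. *)
Section QuotientSpace.

Variables (K : fieldType) (V : vectType K) (W : {vspace V}).

Definition quotv : predArgType := subvs_of (W^C)%VS.
HB.instance Definition _ := Vector.on quotv.

Definition quotv_proj (v : V) : quotv := Subvs (memv_pi (W^C)%VS W v).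
Definition quotv_repr (q : quotv) : V := vsval q.

Fact quotv_proj_linear : linear quotv_proj.
Proof. by move=> k u v; apply/val_inj; rewrite /= linearP. Qed.
HB.instance Definition _ :=
  GRing.isLinear.Build K V quotv *:%R quotv_proj quotv_proj_linear.

Fact quotv_repr_linear : linear quotv_repr.
Proof. by []. Qed.
HB.instance Definition _ :=
  GRing.isLinear.Build K quotv V *:%R quotv_repr quotv_repr_linear.

Let capCW : (W^C :&: W = 0)%VS.
Proof. by rewrite capvC capv_compl. Qed.

Lemma quotv_reprK : cancel quotv_repr quotv_proj.
Proof. by move=> q; apply/val_inj; rewrite /= daddv_pi_id // subvsP. Qed.

Lemma quotv_projK v : v - quotv_repr (quotv_proj v) \in W.
Proof.
have vW : v \in (W^C + W)%VS by rewrite addvC addv_complf memvf.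
by rewrite -{1}(daddv_pi_add capCW vW) addrC addKr memv_pi.
Qed.

Lemma quotv_proj_eq0 v : (quotv_proj v == 0) = (v \in W).
Proof.
apply/eqP/idP=> [v0 | vW].
  by have := quotv_projK v; rewrite v0 [quotv_repr _]linear0 subr0.
have : quotv_repr (quotv_proj v) \in (W^C :&: W)%VS.
  rewrite memv_cap subvsP -[X in X \in W](subKr v).
  by rewrite rpredB ?quotv_projK.
by rewrite capCW memv0 => /eqP q0; rewrite -[LHS]quotv_reprK q0 linear0.
Qed.

End QuotientSpace.

Section SchurFunctor.

Variables (K : fieldType) (AM : schur_pair K).
Local Notation A := (spA AM).
Local Notation M := (spM AM).
Local Notation S := (schur_alg AM).

Variable X : rmodule S.

(* Hom_K(X^*, M) models X ⊗_K M (X is finite dimensional), with pure tensors *)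
(* x ⊗ m = (f |-> f(x) m).                                                   *)
Definition tensK : vectType K := 'Hom('Hom(X, K^o), M).

Definition pure_fun (x : X) (m : M) (f : 'Hom(X, K^o)) : M := (f x : K) *: m.

Fact pure_fun_linear x m : linear (pure_fun x m).
Proof.
by move=> k f g; rewrite /pure_fun add_lfunE scale_lfunE scalerDl scalerA.
Qed.

Definition pure (x : X) (m : M) : tensK := linfun (pure_fun x m).

Lemma pureE x m f : pure x m f = (f x : K) *: m.
Proof. exact/linfun_linearE/pure_fun_linear. Qed.

Lemma pure_linearl m : linear (pure^~ m).
Proof.
move=> k x y; apply/lfunP=> f; rewrite add_lfunE scale_lfunE !pureE linearP.
by rewrite scalerDl scalerA.
Qed.

Lemma pure_linearr x : linear (pure x).
Proof.
move=> k m n; apply/lfunP=> f; rewrite add_lfunE scale_lfunE !pureE.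
by rewrite scalerDr !scalerA mulrC.
Qed.

Definition balance (x : X) (s : S) (m : M) : tensK :=
  pure (ract x s) m - pure x (sact s m).

Fact balance_linear1 s m : linear (fun x => balance x s m).
Proof.
move=> k x y; rewrite /balance ract_linearl !pure_linearl.
by rewrite opprD scalerBr addrACA.
Qed.

Fact balance_linear2 x m : linear (fun s => balance x s m).
Proof.
move=> k s t; rewrite /balance ract_linearr sact_linearl pure_linearl.
by rewrite pure_linearr opprD scalerBr addrACA.
Qed.

Fact balance_linear3 x s : linear (balance x s).
Proof.
move=> k m n; rewrite /balance sact_linearr !pure_linearr.
by rewrite opprD scalerBr addrACA.
Qed.

(* Imposing x s ⊗ m = x ⊗ s m on bases suffices; see mem_balance. *)
Definition balance_space : {vspace tensK} :=
  <<[seq balance x sm.1 sm.2 | x <- vbasis {:X},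
       sm <- [seq (s, m) | s <- vbasis {:S}, m <- vbasis {:M}]]>>%VS.

Lemma mem_balance x s m : balance x s m \in balance_space.
Proof.
apply: (linear_basis_mem (@balance_linear1 s m)) => {}x xb.
apply: (linear_basis_mem (@balance_linear2 x m)) => {}s sb.
apply: (linear_basis_mem (@balance_linear3 x s)) => {}m mb.
apply: memv_span; apply/allpairsP; exists (x, (s, m)); split=> //=.
by apply/allpairsP; exists (s, m).
Qed.

Lemma balance_space_min (U : {vspace tensK}) :
  (forall x s m, balance x s m \in U) -> (balance_space <= U)%VS.
Proof. by move=> bU; apply/span_subvP=> _ /allpairsP[p [_ _ ->]]. Qed.

(* X ⊗_S M; tens_span and tens_universal give its universal property. *)
Definition tensS : vectType K := quotv balance_space.

Definition tens (x : X) (m : M) : tensS := quotv_proj balance_space (pure x m).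

Lemma tens_linearl m : linear (tens^~ m).
Proof. by move=> k x y; rewrite /tens pure_linearl linearP. Qed.

Lemma tens_linearr x : linear (tens x).
Proof. by move=> k m n; rewrite /tens pure_linearr linearP. Qed.

Lemma tens_balanced x s m : tens (ract x s) m = tens x (sact s m).
Proof.
by apply/eqP; rewrite -subr_eq0 -linearB quotv_proj_eq0 mem_balance.
Qed.

Let dualb (i : 'I_(\dim {:X})) : 'Hom(X, K^o) :=
  linfun (coord (vbasis {:X}) i : X -> K^o).

Let dualbE i x : dualb i x = coord (vbasis {:X}) i x.
Proof. by rewrite linfun_linearE // => k y z; rewrite linearP. Qed.

Let dualb_basis (i j : 'I_(\dim {:X})) : dualb i (vbasis {:X})`_j = (i == j)%:R.
Proof. by rewrite dualbE coord_free ?(basis_free (vbasisP _)) // eq_sym. Qed.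

Lemma tensK_sum (t : tensK) :
  t = \sum_(i < \dim {:X}) pure (vbasis {:X})`_i (t (dualb i)).
Proof.
apply/lfunP=> f; rewrite sum_lfunE.
have -> : f = \sum_(i < \dim {:X}) (f (vbasis {:X})`_i : K) *: dualb i.
  apply/lfunP=> x; rewrite sum_lfunE {1}(coord_vbasis (memvf x)) linear_sum.
  by apply: eq_bigr => i _; rewrite linearZ scale_lfunE dualbE; apply: mulrC.
rewrite linear_sum; apply: eq_bigr => i _; rewrite linearZ /= pureE.
congr (_ *: _); rewrite sum_lfunE (bigD1 i) //= scale_lfunE dualb_basis eqxx.
rewrite big1 ?addr0 => [|j ji]; first exact/esym/mulr1.
by rewrite scale_lfunE dualb_basis (negPf ji) scaler0.
Qed.

Lemma tens_span (t : tensS) :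
  exists m : 'I_(\dim {:X}) -> M, t = \sum_(i < \dim {:X}) tens (vbasis {:X})`_i (m i).
Proof.
exists (fun i => quotv_repr t (dualb i)); rewrite -[LHS]quotv_reprK.
by rewrite {1}[quotv_repr t]tensK_sum linear_sum.
Qed.

Lemma tens_universal (V : vectType K) (b : X -> M -> V) :
    (forall m, linear (b^~ m)) -> (forall x, linear (b x)) ->
    (forall x s m, b (ract x s) m = b x (sact s m)) ->
  exists g : 'Hom(tensS, V), forall x m, g (tens x m) = b x m.
Proof.
move=> bl br bS.
pose h (t : tensK) := \sum_(i < \dim {:X}) b (vbasis {:X})`_i (t (dualb i)).
have h_linear : linear h.
  move=> k t u; rewrite /h scaler_sumr -big_split; apply: eq_bigr => i _.
  by rewrite add_lfunE scale_lfunE br.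
have hE x m : h (pure x m) = b x m.
  rewrite [RHS](linear_basis_sum (bl m)); apply: eq_bigr => i _.
  by rewrite pureE dualbE -!(linfun_linearE (br _)) linearZ.
have hW : (balance_space <= lker (linfun h))%VS.
  apply: balance_space_min => x s m; rewrite memv_ker linearB /=.
  by rewrite !linfun_linearE // !hE bS subrr.
exists (linfun h \o linfun (@quotv_repr _ _ balance_space))%VF => x m.
rewrite comp_lfunE lfunE /= -[RHS]hE -[RHS](linfun_linearE h_linear).
apply/eqP; rewrite eq_sym -subr_eq0 -linearB -memv_ker.
exact: (subvP hW _ (quotv_projK _ _)).
Qed.

(* (x ⊗ m) a = x ⊗ m a; see tens_ractE. *)
Definition tens_ract (t : tensS) (a : A) : tensS :=
  quotv_proj balance_space (rmul M a \o quotv_repr t)%VF.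

Fact rmul_pure a x m : (rmul M a \o pure x m)%VF = pure x (ract m a).
Proof.
apply/lfunP=> f; rewrite comp_lfunE !pureE linearZ /=.
by rewrite rmulE.
Qed.

Fact rmul_balance_space a t :
  t \in balance_space -> (rmul M a \o t)%VF \in balance_space.
Proof.
pose h (u : tensK) : tensK := (rmul M a \o u)%VF.
have h_linear : linear h.
  by move=> k u v; rewrite /h comp_lfunDr comp_lfunZr.
have: (balance_space <= linfun h @^-1: balance_space)%VS.
  apply: balance_space_min => x s m; rewrite -memv_preim linfun_linearE //.
  rewrite /h /balance comp_lfunDr comp_lfunNr !rmul_pure -sact_ract.
  exact: mem_balance.
move=> /subvP sub /sub; rewrite -memv_preim.
by rewrite linfun_linearE.
Qed.

Fact tens_ract_proj u a :
  tens_ract (quotv_proj balance_space u) a =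
  quotv_proj balance_space (rmul M a \o u)%VF.
Proof.
apply/eqP; rewrite eq_sym -subr_eq0 -linearB quotv_proj_eq0.
rewrite -comp_lfunNr -comp_lfunDr; apply: rmul_balance_space.
exact: quotv_projK.
Qed.

Lemma tens_ractE x m a : tens_ract (tens x m) a = tens x (ract m a).
Proof. by rewrite tens_ract_proj rmul_pure. Qed.

Fact tens_ract_linearl a : linear (tens_ract^~ a).
Proof.
by move=> k t u; rewrite /tens_ract linearP comp_lfunDr -comp_lfunZr linearP.
Qed.

Fact tens_ract_linearr t : linear (tens_ract t).
Proof.
move=> k a b; rewrite /tens_ract -linearP; congr quotv_proj.
apply/lfunP=> f; rewrite add_lfunE scale_lfunE !comp_lfunE !rmulE.
exact: ract_linearr.
Qed.

Fact tens_ract1 t : tens_ract t 1 = t.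
Proof.
rewrite /tens_ract -[RHS]quotv_reprK; congr quotv_proj.
by apply/lfunP=> f; rewrite comp_lfunE rmulE ract1.
Qed.

Fact tens_ractM t a b : tens_ract t (a * b) = tens_ract (tens_ract t a) b.
Proof.
rewrite {3}/tens_ract tens_ract_proj /tens_ract; congr quotv_proj.
by apply/lfunP=> f; rewrite !comp_lfunE !rmulE ractM.
Qed.

Definition schur_functor : rmodule A :=
  RModule tens_ract_linearl tens_ract_linearr tens_ract1 tens_ractM.

End SchurFunctor.

(* Main.v *)
Require Import Defs.
From HB Require Import structures.
From mathcomp Require Import all_boot all_algebra all_field.

Set Implicit Arguments.
Unset Strict Implicit.
Unset Printing Implicit Defensive.

Import GRing.Theory.
Local Open Scope ring_scope.

(** Let m0 be the element of M that corresponds to the unit of the summand A,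
    and let kappa : M -> A be the projection, so that e x = m0 kappa(x).  An
    element of S that kills the complement of A is determined by the image of
    m0, which can be any m in M; it is [lift m].  Hence M = S m0 is isomorphic
    to S e as a left S-module, A is identified with e S e by
    a |-> [corner a] = [lift (m0 a)], and L (x) M is L e ([acts_functor]).

    As e^* = e, the right S-modules M_R and its dual are both isomorphic to
    e S ([free_on_isomorphic]).  So M_R is projective, and it is also
    injective, being isomorphic to the dual of a projective module.  A
    homomorphism from M_R to L amounts to an element of L e.  A homomorphism
    from L to M_R amounts, through theta, to a functional on L (x) M.  When
    D^lambda <> 0, the first fact makes P^lambda a direct summand of M_R and
    the second one makes L^lambda a submodule of M_R; conversely, a submodule
    of M_R isomorphic to L^lambda gives D^lambda <> 0.  A direct summand of
    M_R is injective.  If P^lambda is injective, then D^lambda <> 0: S embeds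
    in a power of M_R, hence so does P^lambda, as a direct summand, and
    therefore M_R maps nontrivially to L^lambda ([cover_injective_functor]).

    A self-dual P^lambda is the dual of a projective module, so it is
    injective.  Conversely suppose that D^lambda <> 0.  Then P^lambda is a
    direct summand of M_R, so its dual is a direct summand of the dual of M_R
    and is projective.  It therefore suffices to find a nonzero homomorphism
    from that dual to L^lambda: it lifts to a surjection onto P^lambda, which
    is bijective by dimension.  The endomorphisms of M_R are the right
    multiplications by elements of A, so the idempotent that cuts out
    P^lambda is x |-> x a for some a in A.  Through e S, homomorphisms from
    P^lambda, respectively from its dual, to L^lambda correspond to the
    elements of L^lambda in the image of the corner elements s with
    s^* = [corner a], respectively s^*** = [corner (star a)].  Symmetry of A
    forces the star of S on e S e = A to be the involution of A followed by
    an inner automorphism ([corner_twist]), and D^lambda is self-dual, so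
    whether an element acts as zero on D^lambda is unaffected by these stars
    ([acts_twist]).  As the first space is nonzero, so is the second. *)

(** * Linear functionals *)

Section LinearAlgebra.

Variable K : fieldType.

Lemma linear_map0 (X Y : vectType K) (f : X -> Y) : linear f -> f 0 = 0.
Proof. by move=> f_lin; rewrite -(linfun_linearE f_lin) linear0. Qed.

Lemma dim_functionals (X : vectType K) : \dim {:'Hom(X, K^o)} = \dim {:X}.
Proof. by rewrite !dimvf; apply: muln1. Qed.

Lemma lfun_inj_surj (X Y : vectType K) (f : 'Hom(X, Y)) :
  injective f -> \dim {:X} = \dim {:Y} -> forall y, exists x, f x = y.
Proof.
move=> /lker0P/eqP f0 dXY y.
have : y \in limg f.
  rewrite (_ : limg f = fullv) ?memvf //; apply/eqP.
  by rewrite eqEdim subvf -dXY limg_dim_eq //= f0 capv0.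
by case/memv_imgP => x _ ->; exists x.
Qed.

Lemma lfun_surj_bij (X Y : vectType K) (f : 'Hom(X, Y)) :
  (forall y, exists x, f x = y) -> \dim {:X} = \dim {:Y} -> bijective f.
Proof.
move=> f_surj dXY.
have f0 : lker f == 0%VS.
  rewrite -dimv_eq0 -(eqn_add2r (\dim {:Y})) add0n -{2}dXY.
  rewrite -(limg_ker_dim f fullv) capfv; apply/eqP; congr (_ + _)%N.
  suff -> : limg f = fullv by [].
  apply/eqP; rewrite eqEsubv subvf; apply/subvP => y _.
  by have [x <-] := f_surj y; apply/memv_img/memvf.
exists (f^-1)%VF; first exact: lker0_lfunK.
by move=> y; have [x <-] := f_surj y; rewrite lker0_lfunK.
Qed.

Lemma functional_separates (X : vectType K) (x : X) :
  x != 0 -> exists phi : 'Hom(X, K^o), phi x != 0.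
Proof.
move=> x0; have [i xi] : exists i, coord (vbasis {:X}) i x != 0.
  apply/existsP; apply: contraR x0; rewrite negb_exists => /forallP c0.
  rewrite (coord_vbasis (memvf x)) big1 // => i _.
  by move: (c0 i); rewrite negbK => /eqP ->; rewrite scale0r.
exists (linfun (coord (vbasis {:X}) i : X -> K^o)).
by rewrite linfun_linearE // => k y z; rewrite linearP.
Qed.

Lemma functionals_eq0 (X : vectType K) (x : X) :
  (forall phi : 'Hom(X, K^o), phi x = 0) -> x = 0.
Proof.
move=> phi0; apply/eqP/negPn/negP => /functional_separates[phi].
by rewrite phi0 eqxx.
Qed.

End LinearAlgebra.

(** * Modules over a finite dimensional algebra *)

Section Modules.

Variables (K : fieldType) (B : falgType K).
Implicit Types X Y Z P Q L : rmodule B.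

Lemma ract0l X b : ract (0 : X) b = 0.
Proof. by rewrite -rmulE linear0. Qed.

Lemma ractDl X (x y : X) b : ract (x + y) b = ract x b + ract y b.
Proof. by rewrite -!rmulE linearD. Qed.

Lemma ract_suml X n (x : 'I_n -> X) b :
  ract (\sum_i x i) b = \sum_i ract (x i) b.
Proof.
by rewrite -rmulE linear_sum; apply: eq_bigr => i _; rewrite /= rmulE.
Qed.

Lemma ractDr X (x : X) b c : ract x (b + c) = ract x b + ract x c.
Proof. by have := ract_linearr x 1 b c; rewrite !scale1r. Qed.

Lemma ract0r X (x : X) : ract x 0 = 0.
Proof. by apply/(addrI (ract x 0)); rewrite -ractDr !addr0. Qed.

Lemma ractNr X (x : X) b : ract x (- b) = - ract x b.
Proof.
by have := ract_linearr x (-1) b 0; rewrite addr0 !scaleN1r ract0r addr0.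
Qed.

Lemma ractBr X (x : X) b c : ract x (b - c) = ract x b - ract x c.
Proof. by rewrite ractDr ractNr. Qed.

(** Nonvanishing of [X b], in the form in which it passes between the modules
    [L] and [L (x) M] and between a module and its dual. *)
Definition acts X (b : B) : Prop := exists x : X, ract x b != 0.

Definition rhom_of X Y (f : X -> Y) (f_lin : linear f)
    (f_act : forall x b, f (ract x b) = ract (f x) b) : rhom X Y.
Proof.
by exists (linfun f) => x b; rewrite !(linfun_linearE f_lin).
Defined.

Lemma rhom_ofE X Y (f : X -> Y) f_lin f_act :
  @rhom_of X Y f f_lin f_act =1 f.
Proof. exact: linfun_linearE. Qed.

Definition rid X : rhom X X.
Proof. by exists \1%VF => x b; rewrite !id_lfunE. Defined.

Lemma ridE X x : rid X x = x.
Proof. exact: id_lfunE. Qed.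

Definition rcomp X Y Z (g : rhom Y Z) (f : rhom X Y) : rhom X Z.
Proof.
by exists (g \o f)%VF => x b; rewrite !comp_lfunE !rhomP.
Defined.

Lemma rcompE X Y Z (g : rhom Y Z) (f : rhom X Y) x : rcomp g f x = g (f x).
Proof. exact: comp_lfunE. Qed.

Lemma rhom_inverse X Y (f : rhom X Y) :
  bijective f -> exists g : rhom Y X, cancel f g /\ cancel g f.
Proof.
move=> f_bij; have f0 : lker f == 0%VS by apply/lker0P/bij_inj.
have fK : cancel f (f^-1)%VF by exact: lker0_lfunK.
have Kf : cancel (f^-1)%VF f.
  by have [g gK Kg] := f_bij => y; rewrite -[y]Kg fK.
unshelve eexists (@RHom _ _ _ _ (f^-1)%VF _) => //.
by move=> y b; apply: (can_inj fK); rewrite rhomP !Kf.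
Qed.

(** Projectivity, injectivity and duals pass along split embeddings more easily
    than along internal direct sums; [retract_summand] and [summand_retract]
    compare the two. *)
Definition retract X Y : Prop :=
  exists (i : rhom X Y) (p : rhom Y X), cancel i p.

Lemma isomorphic_sym X Y : isomorphic X Y -> isomorphic Y X.
Proof.
case=> f; have [g [fK Kf]] := rhom_inverse (riso_bij f).
by constructor; exists g; exists f.
Qed.

Lemma isomorphic_retract X Y : isomorphic X Y -> retract X Y.
Proof.
by case=> f; have [g [fK _]] := rhom_inverse (riso_bij f); exists f, g.
Qed.

Lemma retract_projective X Y :
  retract X Y -> projective_mod Y -> projective_mod X.
Proof.
move=> [i [p ip]] Y_proj Z W q f q_surj.
have [g gE] := Y_proj _ _ q (rcomp f p) q_surj.
by exists (rcomp g i) => x; rewrite rcompE gE rcompE ip.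
Qed.

Lemma retract_injective X Y :
  retract X Y -> injective_mod Y -> injective_mod X.
Proof.
move=> [i [p ip]] Y_inj Z W j f j_inj.
have [g gE] := Y_inj _ _ j (rcomp i f) j_inj.
by exists (rcomp p g) => x; rewrite rcompE gE rcompE ip.
Qed.

Lemma projective_split Q P (p : rhom Q P) :
  projective_mod P -> surj p -> exists i : rhom P Q, cancel i p.
Proof.
move=> P_proj p_surj; have [i iE] := P_proj _ _ p (rid P) p_surj.
by exists i => x; rewrite iE ridE.
Qed.

Definition rkernel X Y (f : rhom X Y) : rsub X.
Proof.
by exists (lker f) => x b; rewrite !memv_ker rhomP => /eqP->; rewrite ract0l.
Defined.

Definition rimage X Y (f : rhom X Y) : rsub Y.
Proof.
exists (limg f) => y b /memv_imgP[x _ ->].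
by rewrite -rhomP memv_img ?memvf.
Defined.

Lemma image_isomorphic X Y (f : rhom X Y) :
  injective f -> isomorphic X (submodule (rimage f)).
Proof.
move=> f_inj; pose g x : submodule (rimage f) := Subvs (memv_img f (memvf x)).
have g_lin : linear g by move=> k x y; apply/val_inj; rewrite /= linearP.
have g_act x b : g (ract x b) = ract (g x) b by apply/val_inj; rewrite /= rhomP.
constructor; exists (rhom_of g_lin g_act).
have gK : cancel g (fun y => (f^-1)%VF (vsval y)).
  by move=> x; rewrite /= lker0_lfunK //; apply/lker0P.
exists (fun y : submodule (rimage f) => (f^-1)%VF (vsval y)) => y.
  by rewrite rhom_ofE gK.
by rewrite rhom_ofE; apply/val_inj; rewrite /= limg_lfunVK ?subvsP.
Qed.

Definition inclusion Y (U : rsub Y) : rhom (submodule U) Y.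
Proof. by exists (linfun vsval) => x b; rewrite !lfunE. Defined.

Lemma inclusionE Y (U : rsub Y) (u : submodule U) : inclusion U u = vsval u.
Proof. exact: lfunE. Qed.

Lemma retract_summand X Y : retract X Y -> isom_summand X Y.
Proof.
move=> [i [p ip]]; exists (rimage i), (rkernel p); split; last first.
  exact/image_isomorphic/(can_inj ip).
split.
  apply/eqP; rewrite eqEsubv subvf; apply/subvP => y _.
  rewrite -(subrK (i (p y)) y) addrC memv_add ?memv_img ?memvf //.
  by rewrite memv_ker linearB /= ip subrr.
apply/eqP; rewrite -subv0; apply/subvP => y /memv_capP[/memv_imgP[x _ ->]].
by rewrite memv_ker ip => /eqP->; rewrite linear0 mem0v.
Qed.

(** The projection along [V] is [B]-linear because [V] as well as [U] is stable
    under the action. *)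
Lemma summand_proj Y (U V : rsub Y) :
  internal_sum U V ->
  exists p : rhom Y (submodule U),
    (forall u, u \in U -> vsval (p u) = u) /\ (forall v, v \in V -> p v = 0).
Proof.
move=> [UV_full UV_cap].
pose q y : submodule U := Subvs (memv_pi U V y).
have q_lin : linear q by move=> k x y; apply/val_inj; rewrite /= linearP.
have piV v : v \in V -> daddv_pi U V v = 0.
  move=> vV; have := daddv_pi_add (w := v) UV_cap.
  rewrite UV_full memvf => /(_ isT).
  rewrite [X in _ + X]daddv_pi_id //; first by rewrite -[RHS]add0r => /addIr.
  by rewrite capvC.
have q_act y b : q (ract y b) = ract (q y) b.
  apply/val_inj => /=.
  have : y \in (U + V)%VS by rewrite UV_full memvf.
  case/memv_addP => u uU [v vV ->]; rewrite ractDl !linearD /= (piV v) //.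
  by rewrite (piV (ract v b)) ?rsubP // !daddv_pi_id ?rsubP // !addr0.
exists (rhom_of q_lin q_act); split=> y yUV; rewrite rhom_ofE.
  exact: daddv_pi_id.
by apply/val_inj; rewrite /= piV.
Qed.

Lemma summand_retract X Y : isom_summand X Y -> retract X Y.
Proof.
move=> [U [V [UV [f]]]]; have [p [pU _]] := summand_proj UV.
have [g [fK Kf]] := rhom_inverse (riso_bij f).
exists (rcomp (inclusion U) f), (rcomp g p) => x; rewrite !rcompE inclusionE.
rewrite (_ : p _ = f x) //.
by apply/val_inj; rewrite [LHS]pU // subvsP.
Qed.

Lemma simple_target_surj X L (f : rhom X L) x :
  simple_mod L -> f x != 0 -> surj f.
Proof.
move=> [_ /(_ (rimage f))[] imf] fx y.
have := memv_img f (memvf x); have /= -> := imf.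
  by rewrite memv0 (negPf fx).
have : y \in limg f by have /= -> := imf; rewrite memvf.
by case/memv_imgP => z _ ->; exists z.
Qed.

Lemma simple_source_inj L X (f : rhom L X) x :
  simple_mod L -> f x != 0 -> injective f.
Proof.
move=> [_ /(_ (rkernel f))[/= /eqP/lker0P //|/= kf]] /negP[].
by rewrite -memv_ker kf memvf.
Qed.

(** Lift [f] through the cover [P -> L].  The image of the lift, together with
    the kernel of the cover, spans [P], and that kernel is superfluous. *)
Lemma cover_surj Q P L (f : rhom Q L) :
  projective_cover P L -> projective_mod Q -> surj f ->
  exists g : rhom Q P, surj g.
Proof.
move=> [_ [p [p_surj p_min]]] Q_proj f_surj.
have [g gE] := Q_proj _ _ p f p_surj; exists g => y.
have : y \in limg g.
  have /= -> := p_min (rimage g); first exact: memvf.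
    apply/eqP; rewrite eqEsubv subvf; apply/subvP => z _.
    have [x fx] := f_surj (p z).
    rewrite -(subrK (g x) z) addrC memv_add ?memv_img ?memvf //.
    by rewrite memv_ker linearB /= gE fx subrr.
by case/memv_imgP => x _ ->; exists x.
Qed.

(** The isomorphism [e b |-> q b] from the right ideal [e B] to [Q], expressed
    through its generator. *)
Definition free_on (e : B) Q (q : Q) : Prop :=
  [/\ ract q e = q, forall y, exists b, y = ract q b
    & forall b, ract q b = 0 -> e * b = 0].

Section FreeOn.

Variables (e : B) (Q : rmodule B) (q : Q).
Hypothesis Qq : free_on e q.

(** This is Hom(e B, X) = X e. *)
Lemma free_on_hom X (x : X) : ract x e = x -> exists h : rhom Q X, h q = x.
Proof.
move=> xe; have [qe q_gen q_ann] := Qq.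
have x_ann b : ract q b = 0 -> ract x b = 0.
  by move=> /q_ann eb; rewrite -xe -ractM eb ract0r.
pose g : 'Hom(B, Q) := linfun (ract q).
have gE b : g b = ract q b by exact/linfun_linearE/ract_linearr.
have gK y : ract q ((g^-1)%VF y) = y.
  rewrite -gE limg_lfunVK //; have [b ->] := q_gen y.
  by rewrite -gE memv_img ?memvf.
have x_eq b c : ract q b = ract q c -> ract x b = ract x c.
  by move=> bc; apply/subr0_eq; rewrite -ractBr x_ann // ractBr bc subrr.
pose h y := ract x ((g^-1)%VF y).
have h_lin : linear h by move=> k y z; rewrite /h linearP ract_linearr.
have h_act y b : h (ract y b) = ract (h y) b.
  by rewrite /h -ractM; apply: x_eq; rewrite ractM !gK.
exists (rhom_of h_lin h_act); rewrite rhom_ofE /h -[RHS]ract1; apply: x_eq.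
by rewrite gK ract1.
Qed.

Lemma free_on_ext X (f g : rhom Q X) : f q = g q -> f =1 g.
Proof.
by have [_ q_gen _] := Qq => fg y; have [b ->] := q_gen y; rewrite !rhomP fg.
Qed.

Lemma free_on_projective : projective_mod Q.
Proof.
move=> X Y p f p_surj; have [qe _ _] := Qq.
have [x px] := p_surj (f q).
have [|g gq] := @free_on_hom X (ract x e).
  rewrite -ractM; have [_ _ q_ann] := Qq; congr ract; apply/subr0_eq.
  by rewrite -[X in _ - X]mulr1 -mulrBr q_ann // ractBr ract1 qe subrr.
exists g => y; rewrite -rcompE; apply: (@free_on_ext Y (rcomp p g)).
by rewrite rcompE gq rhomP px -rhomP qe.
Qed.

Lemma free_on_hom_neq0 X (h : rhom Q X) y : h y != 0 -> h q != 0.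
Proof.
have [_ q_gen _] := Qq; have [b ->] := q_gen y; rewrite rhomP.
by apply: contra => /eqP ->; rewrite ract0l.
Qed.

End FreeOn.

Lemma free_on_isomorphic e X Y (x : X) (y : Y) :
  free_on e x -> free_on e y -> isomorphic X Y.
Proof.
move=> Xx Yy; have [xe _ _] := Xx; have [ye _ _] := Yy.
have [f fx] := free_on_hom Xx ye; have [g gy] := free_on_hom Yy xe.
have gf : cancel f g.
  move=> z; have [_ x_gen _] := Xx; have [b ->] := x_gen z.
  by rewrite !rhomP fx gy.
have fg : cancel g f.
  move=> z; have [_ y_gen _] := Yy; have [b ->] := y_gen z.
  by rewrite !rhomP gy fx.
by constructor; exists f; exists g.
Qed.

End Modules.

(** * Duality *)

Section Duality.

Variables (K : fieldType) (B : falgType K) (sigma : anti_hom B).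
Implicit Types X Y P : rmodule B.

Definition dual_hom X Y (f : rhom X Y) :
  rhom (dual_mod sigma Y) (dual_mod sigma X).
Proof.
pose g (phi : dual_mod sigma Y) : dual_mod sigma X := (phi \o f)%VF.
apply: (@rhom_of _ _ _ _ g) => [k phi psi|phi b]; apply/lfunP => x.
  by rewrite !(add_lfunE, scale_lfunE, comp_lfunE).
by rewrite comp_lfunE !dual_ractE comp_lfunE rhomP.
Defined.

Lemma dual_homE X Y (f : rhom X Y) phi x : dual_hom f phi x = phi (f x).
Proof. by rewrite rhom_ofE comp_lfunE. Qed.

Lemma dual_retract X Y :
  retract X Y -> retract (dual_mod sigma X) (dual_mod sigma Y).
Proof.
move=> [i [p ip]]; exists (dual_hom p), (dual_hom i) => phi.
by apply/lfunP => x; rewrite !dual_homE ip.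
Qed.

Lemma anti_inverse : injective sigma ->
  exists sigma' : anti_hom B, cancel sigma sigma' /\ cancel sigma' sigma.
Proof.
move=> sigma_inj; pose f : 'End(B) := linfun sigma.
have fE : f =1 sigma by exact/linfun_linearE/anti_linear.
have f0 : lker f == 0%VS.
  by apply/lker0P => x y; rewrite !fE; apply: sigma_inj.
have fK x : (f^-1)%VF (sigma x) = x by rewrite -fE lker0_lfunK.
have Kf x : sigma ((f^-1)%VF x) = x by rewrite -fE lker0_lfunVK.
unshelve eexists (@AntiHom _ _ (f^-1)%VF _ _ _) => //.
- by move=> k x y; rewrite linearP.
- by rewrite -[RHS]fK anti1.
- by move=> x y; apply: sigma_inj; rewrite antiM !Kf.
Qed.

(** Duality is exact and reverses arrows, so a lifting problem for [P] takes
    the place of an extension problem for its dual. *)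
Lemma dual_projective_injective P :
  injective sigma -> projective_mod P -> injective_mod (dual_mod sigma P).
Proof.
move=> /anti_inverse[sigma' [sK Ks]] P_proj X Y i f i_inj.
(* Homomorphisms X -> P^* correspond to homomorphisms P -> X^*, the dual now
   being formed with the inverse of sigma. *)
have [res resE] : exists res : rhom (dual_mod sigma' Y) (dual_mod sigma' X),
    forall phi x, res phi x = phi (i x).
  pose g (phi : dual_mod sigma' Y) : dual_mod sigma' X := (phi \o i)%VF.
  have g_lin : linear g.
    move=> k phi psi; apply/lfunP => x.
    by rewrite !(add_lfunE, scale_lfunE, comp_lfunE).
  have g_act phi b : g (ract phi b) = ract (g phi) b.
    by apply/lfunP => x; rewrite comp_lfunE !dual_ractE comp_lfunE rhomP.
  by exists (rhom_of g_lin g_act) => phi x; rewrite rhom_ofE comp_lfunE.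
have res_surj : surj res.
  move=> phi; exists (phi \o i^-1)%VF; apply/lfunP => x.
  by rewrite resE comp_lfunE lker0_lfunK //; apply/lker0P.
pose fT p : dual_mod sigma' X := linfun (fun x => f x p).
have fTE p x : fT p x = f x p.
  rewrite linfun_linearE // => k y z.
  by rewrite linearP add_lfunE scale_lfunE.
have fT_lin : linear fT.
  move=> k p r; apply/lfunP => x.
  by rewrite add_lfunE scale_lfunE !fTE linearP.
have fT_act p b : fT (ract p b) = ract (fT p) b.
  apply/lfunP => x; rewrite dual_ractE !fTE rhomP dual_ractE.
  by congr (f x (ract p _)); apply/esym/Ks.
have [g gE] := P_proj _ _ res (rhom_of fT_lin fT_act) res_surj.
have {}gE p x : g p (i x) = f x p by rewrite -resE gE rhom_ofE fTE.
pose gT y : dual_mod sigma P := linfun (fun p => g p y).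
have gTE y p : gT y p = g p y.
  rewrite linfun_linearE // => k r s.
  by rewrite linearP add_lfunE scale_lfunE.
have gT_lin : linear gT.
  move=> k y z; apply/lfunP => p.
  by rewrite add_lfunE scale_lfunE !gTE linearP.
have gT_act y b : gT (ract y b) = ract (gT y) b.
  apply/lfunP => p; rewrite dual_ractE !gTE rhomP dual_ractE.
  by congr (g p (ract y _)); apply/esym/sK.
exists (rhom_of gT_lin gT_act) => x; apply/lfunP => p.
by rewrite rhom_ofE gTE gE.
Qed.

End Duality.

(** * The bimodule of a self-dual Schur pair *)

Section SchurPair.

Variables (K : fieldType) (AM : schur_pair K).
Local Notation A := (spA AM).
Local Notation M := (spM AM).
Local Notation S := (schur_alg AM).

Lemma schur_ext (s t : S) : sact s =1 sact t -> s = t.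
Proof. by move=> st; apply/val_inj/lfunP => x; apply: st. Qed.

Lemma sact0l x : sact (0 : S) x = 0.
Proof. exact: zero_lfunE. Qed.

Lemma functor_act_neq0_tens (X : rmodule S) (t : schur_functor X) a :
  ract t a != 0 -> exists x m, tens x (ract m a) != 0 :> schur_functor X.
Proof.
move=> ta; have [m tE] := tens_span t.
have /existsP[i ti] : [exists i : 'I_(\dim {:X}),
    tens (vbasis {:X})`_i (ract (m i) a) != 0 :> schur_functor X].
  apply: contraR ta; rewrite negb_exists => /forallP t0.
  rewrite tE (@ract_suml _ _ (schur_functor X)) big1 // => i _.
  by move: (t0 i); rewrite negbK => /eqP <-; apply: tens_ractE.
by exists (vbasis {:X})`_i, (m i).
Qed.

Variables (star : anti_involution A) (theta : riso M (dual_mod star M)).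
Local Notation sstar := (schur_star theta).
Local Notation MR := (MR_mod theta).

Lemma theta_surj (phi : 'Hom(M, K^o)) : exists x, theta x = phi.
Proof. by have [g _ Kg] := riso_bij theta; exists (g phi). Qed.

Lemma theta_separates y : (forall x, theta x y = 0) -> y = 0.
Proof.
move=> y0; apply: functionals_eq0 => phi.
by have [x <-] := theta_surj phi.
Qed.

Lemma theta_sstar s x y : theta (sact (sstar s) x) y = theta x (sact s y).
Proof. exact: schur_starE. Qed.

Lemma theta_ract x a y : theta (ract x a) y = theta x (ract y (star a)).
Proof. by rewrite rhomP dual_ractE. Qed.

Lemma sstar_inj : injective sstar.
Proof.
move=> s t st; apply: schur_ext => y; apply/subr0_eq/theta_separates => x.
by rewrite linearB /= -!theta_sstar st subrr.
Qed.

Lemma MR_ractE (x : MR) s : ract x s = sact (sstar s) x.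
Proof. by []. Qed.

(** Homomorphisms from [X] to [M_R] are functionals on [X (x) M]: a homomorphism
    [f] gives the pairing [theta (f x) m], and [theta] turns the star of [S],
    by which [S] acts on [M_R], into the left action on [M]. *)
Lemma functional_to_MR (X : rmodule S) (g : 'Hom(schur_functor X, K^o)) :
  exists f : rhom X MR, forall x m, theta (f x) m = g (tens x m).
Proof.
have [thetaV [_ Ktheta]] := rhom_inverse (riso_bij theta).
pose form (x : X) : 'Hom(M, K^o) := linfun (fun m => g (tens x m)).
have formE x m : form x m = g (tens x m).
  by rewrite linfun_linearE // => k y z; rewrite tens_linearr linearP.
pose f x : MR := thetaV (form x).
have fE x m : theta (f x) m = g (tens x m) by rewrite Ktheta formE.
have f_lin : linear f.
  move=> k x y; rewrite /f -linearP; congr (thetaV _).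
  apply/lfunP => m; rewrite add_lfunE scale_lfunE !formE.
  by rewrite tens_linearl linearP.
have f_act x s : f (ract x s) = ract (f x) s.
  apply: (bij_inj (riso_bij theta)); apply/lfunP => m.
  by rewrite fE tens_balanced -fE -theta_sstar.
by exists (rhom_of f_lin f_act) => x m; rewrite rhom_ofE fE.
Qed.

Lemma MR_hom_tens_neq0 (X : rmodule S) (f : rhom X MR) x :
  f x != 0 -> nonzero (schur_functor X).
Proof.
move=> fx.
have [||x' s m|g gE] := @tens_universal _ _ X K^o (fun x m => theta (f x) m).
- by move=> m k y z; rewrite !linearP add_lfunE scale_lfunE.
- by move=> y k m n; rewrite linearP.
- by rewrite rhomP theta_sstar.
have /lfunPn[m xm] : theta (f x) != 0.
  apply: contra fx => /eqP fx; apply/eqP/(bij_inj (riso_bij theta)).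
  by rewrite fx linear0.
exists (tens x m); apply: contra xm => /eqP xm.
by rewrite -gE xm linear0 zero_lfunE.
Qed.

Lemma simple_sub_MR (L : rmodule S) : simple_mod L ->
  nonzero (schur_functor L) <-> isom_submodule L MR.
Proof.
move=> L_simple; split=> [[t t0] | [U [j]]].
  have [x [m xm]] : exists x m, tens x (ract m 1) != 0 :> schur_functor L.
    by apply: (@functor_act_neq0_tens _ t); rewrite ract1.
  have [g gxm] := functional_separates xm.
  have [f fE] := functional_to_MR g.
  exists (rimage f).
  apply/image_isomorphic/(@simple_source_inj _ _ _ _ _ x) => //.
  apply: contra gxm => /eqP fx; rewrite -fE fx.
  by rewrite linear0 zero_lfunE.
have [[x x0] _] := L_simple.
apply: (@MR_hom_tens_neq0 L (rcomp (inclusion U) j) x).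
rewrite rcompE inclusionE; apply: contra x0 => /eqP jx; apply/eqP.
by apply: (bij_inj (riso_bij j)); apply/val_inj; rewrite linear0.
Qed.

End SchurPair.

(** * A regular direct summand *)

Section RegularSummand.

Variables (K : fieldType) (AM : schur_pair K).
Local Notation A := (spA AM).
Local Notation M := (spM AM).
Local Notation S := (schur_alg AM).
Variables (kappa : rhom M (regular_mod A)) (m0 : M) (e : S).
Hypothesis kappa_m0 : kappa m0 = 1.
Hypothesis eE : forall x, sact e x = ract m0 (kappa x).

Fact lift_subproof m :
  (linfun (fun x : M => ract m (kappa x : A)) : 'End(M)) \in endv AM.
Proof.
have lin : linear (fun x : M => ract m (kappa x : A)).
  by move=> k x y; rewrite linearP ract_linearr.
by apply/endvP => x a; rewrite !(linfun_linearE lin) rhomP ractM.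
Qed.

(** [lift m] sends [m0] to [m] and kills the kernel of [kappa], so that
    [m |-> lift m] is the inverse of the isomorphism [s |-> s m0] from [S e]
    to [M]. *)
Definition lift m : S := Subvs (lift_subproof m).

Lemma liftE m x : sact (lift m) x = ract m (kappa x : A).
Proof.
by apply: linfun_linearE => k y z; rewrite linearP ract_linearr.
Qed.

Lemma lift_m0 m : sact (lift m) m0 = m.
Proof. by rewrite liftE kappa_m0 ract1. Qed.

Lemma mul_lift s m : s * lift m = lift (sact s m).
Proof. by apply: schur_ext => x; rewrite sactM !liftE sact_ract. Qed.

Lemma mul_e s : s * e = lift (sact s m0).
Proof. by apply: schur_ext => x; rewrite sactM eE liftE sact_ract. Qed.

Lemma e_m0 : sact e m0 = m0.
Proof. by rewrite eE kappa_m0 ract1. Qed.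

Lemma sact_m0_eq0 s : sact s m0 = 0 -> s * e = 0.
Proof.
move=> s0; rewrite mul_e s0; apply: schur_ext => x.
by rewrite liftE ract0l sact0l.
Qed.

Lemma lift_linear : linear lift.
Proof.
move=> k m n; apply: schur_ext => x.
by rewrite sact_linearl !liftE ract_linearl.
Qed.

(** The identification of [A] with [e S e]. *)
Definition corner (a : A) : S := lift (ract m0 a).

Lemma corner_m0 a : sact (corner a) m0 = ract m0 a.
Proof. exact: lift_m0. Qed.

Lemma e_corner a : e * corner a = corner a.
Proof. by rewrite mul_lift sact_ract e_m0. Qed.

Lemma corner1 : corner 1 = e.
Proof. by rewrite /corner ract1 -[RHS]mul1r mul_e sact1. Qed.

Lemma e_idem : e * e = e.
Proof. by rewrite -{2}corner1 e_corner corner1. Qed.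

(** Every tensor [x (x) m] equals [x (lift m) (x) m0], which reduces
    [X (x) M] to [X e], with [a] acting as [corner a]. *)
Lemma acts_functor (X : rmodule S) a :
  acts (schur_functor X) a <-> acts X (corner a).
Proof.
split=> [[t] /functor_act_neq0_tens[x [m xm]] | [x xa]].
  exists (ract x (lift m)); rewrite -ractM mul_lift sact_ract lift_m0.
  apply: contra xm => /eqP xm; apply/eqP.
  rewrite -[ract m a]lift_m0 -tens_balanced xm.
  exact: linear_map0 (tens_linearl m0).
have [||y s m|g gE] := @tens_universal _ _ X X (fun x m => ract x (lift m)).
- by move=> m; apply: ract_linearl.
- by move=> y k m n; rewrite lift_linear ract_linearr.
- by rewrite -ractM mul_lift.
exists (tens x m0); rewrite [ract _ _]tens_ractE.
by apply: contra xa => /eqP xm; rewrite -/(corner a) -gE xm linear0.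
Qed.

Lemma nonzero_functor (X : rmodule S) :
  nonzero (schur_functor X) <-> acts X e.
Proof.
rewrite -corner1; split=> [[t t0] | /acts_functor[t t1]].
  by apply/acts_functor; exists t; rewrite ract1.
by exists t; rewrite ract1 in t1.
Qed.

Variables (star : anti_involution A) (theta : riso M (dual_mod star M)).
Local Notation sstar := (schur_star theta).
Local Notation MR := (MR_mod theta).
Local Notation MR_dual := (dual_mod sstar MR).
Hypothesis e_star : schur_star theta e = e.

Lemma MR_free_on : free_on e (m0 : MR).
Proof.
split=> [|y|s s0].
- by rewrite MR_ractE e_star e_m0.
- have [sstar' [_ Ks]] := anti_inverse (@sstar_inj _ _ _ theta).
  by exists (sstar' (lift y)); rewrite MR_ractE Ks lift_m0.
- apply: (@sstar_inj _ _ _ theta); rewrite antiM e_star.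
  by rewrite (sact_m0_eq0 s0); apply/esym/(linear_map0 (anti_linear _)).
Qed.

(** One star comes from the dual, one from the action on [M_R], and one from
    moving an element of [S] across [theta]. *)
Lemma MR_dual_ract (y : M) (s : S) :
  ract (theta y : MR_dual) s = theta (sact (sstar (sstar (sstar s))) y).
Proof.
by apply/lfunP => x; rewrite dual_ractE !theta_sstar.
Qed.

Lemma MR_dual_free_on : free_on e (theta m0 : MR_dual).
Proof.
have star0 s : sstar s = 0 -> s = 0.
  move=> s0; apply: (@sstar_inj _ _ _ theta); rewrite s0.
  by apply/esym/(linear_map0 (anti_linear _)).
split=> [|phi|s].
- by rewrite MR_dual_ract !e_star e_m0.
- have [sstar' [_ Ks]] := anti_inverse (@sstar_inj _ _ _ theta).
  have [y <-] := theta_surj theta phi.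
  exists (sstar' (sstar' (sstar' (lift y)))).
  by rewrite MR_dual_ract !Ks lift_m0.
- rewrite MR_dual_ract -[0](linear0 theta) => /(bij_inj (riso_bij theta)).
  move=> /sact_m0_eq0 s0; apply/star0/star0/star0.
  by rewrite !antiM !e_star.
Qed.

Lemma MR_projective : projective_mod MR.
Proof. exact: free_on_projective MR_free_on. Qed.

(** [M_R] is isomorphic to its own dual, the dual of a projective module. *)
Lemma MR_injective : injective_mod MR.
Proof.
have [i] := free_on_isomorphic MR_free_on MR_dual_free_on.
apply: (retract_injective (isomorphic_retract (inhabits i))).
exact/dual_projective_injective/MR_projective/sstar_inj.
Qed.

Lemma MR_hom_functor (X : rmodule S) (h : rhom MR X) m :
  h m != 0 -> nonzero (schur_functor X).
Proof.
move/(free_on_hom_neq0 MR_free_on) => h0; apply/nonzero_functor; exists (h m0).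
by rewrite -rhomP; have [-> _ _] := MR_free_on.
Qed.

(** A nonzero element of [L e] gives a homomorphism from [M_R] onto [L].  It
    lifts to a surjection onto the projective cover, and that splits. *)
Lemma cover_retract_MR (P L : rmodule S) :
  simple_mod L -> projective_cover P L -> nonzero (schur_functor L) ->
  retract P MR.
Proof.
move=> L_simple P_cover /nonzero_functor[l le].
have [|h hm0] := @free_on_hom _ _ _ _ _ MR_free_on L (ract l e).
  by rewrite -ractM e_idem.
have h_surj : surj h.
  by apply: (@simple_target_surj _ _ MR L h m0); rewrite ?hm0.
have [g g_surj] := cover_surj P_cover MR_projective h_surj.
have [P_proj _] := P_cover.
by have [i gi] := projective_split P_proj g_surj; exists i, g.
Qed.

(** Hom_K(M, M_R), which is a direct sum of copies of [M_R] described without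
    choosing a basis; [S] embeds in it because it acts faithfully on [M]. *)
Definition power_ract (f : 'End(M)) (s : S) : 'End(M) :=
  (vsval (sstar s) \o f)%VF.

Lemma power_ractE f s x : power_ract f s x = ract (f x : MR) s.
Proof. exact: comp_lfunE. Qed.

Fact power_ract_linearl s : linear (power_ract^~ s).
Proof. by move=> k f g; rewrite /power_ract comp_lfunDr -comp_lfunZr. Qed.

Fact power_ract_linearr f : linear (power_ract f).
Proof.
move=> k s t; apply/lfunP => x.
by rewrite add_lfunE scale_lfunE !power_ractE ract_linearr.
Qed.

Fact power_ract1 f : power_ract f 1 = f.
Proof. by apply/lfunP => x; rewrite power_ractE ract1. Qed.

Fact power_ractM f s t : power_ract f (s * t) = power_ract (power_ract f s) t.
Proof. by apply/lfunP => x; rewrite !power_ractE ractM. Qed.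

Definition MR_power : rmodule S :=
  RModule power_ract_linearl power_ract_linearr power_ract1 power_ractM.

(** The module is a sum of images of [M_R]: every endomorphism of [M] is a sum
    of rank one maps [x |-> c(x) m], for coordinate functions [c], and each of
    these depends [S]-linearly on [m] in [M_R]. *)
Lemma MR_power_hom_functor (X : rmodule S) (h : rhom MR_power X) f :
  h f != 0 -> nonzero (schur_functor X).
Proof.
pose b := vbasis {:M}.
have rank1_lin i (m : M) : linear (fun x : M => coord b i x *: m).
  by move=> k x y; rewrite linearP scalerDl scalerA.
pose rank1 i m : 'End(M) := linfun (fun x : M => coord b i x *: m).
have rank1E i m x : rank1 i m x = coord b i x *: m.
  exact: (linfun_linearE (rank1_lin i m)).
pose F i (m : MR) : MR_power := rank1 i m.
have rank1_linr i : linear (F i).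
  move=> k m n; apply/lfunP => x.
  by rewrite add_lfunE scale_lfunE !rank1E scalerDr !scalerA mulrC.
have rank1_act i m s : F i (ract m s) = ract (F i m) s.
  apply/lfunP => x; rewrite power_ractE !rank1E.
  by rewrite -!rmulE linearZ.
have -> : f = \sum_(i < \dim {:M}) F i (f b`_i).
  apply/lfunP => x; rewrite sum_lfunE {1}(coord_vbasis (memvf x)) linear_sum.
  by apply: eq_bigr => i _; rewrite rank1E linearZ.
rewrite linear_sum => hf.
have /existsP[i hi] : [exists i : 'I_(\dim {:M}), h (F i (f b`_i)) != 0].
  apply: contraR hf; rewrite negb_exists => /forallP h0.
  by rewrite big1 // => i _; move: (h0 i); rewrite negbK => /eqP.
pose rank1_hom := rhom_of (rank1_linr i) (rank1_act i).
apply: (@MR_hom_functor X (rcomp h rank1_hom) (f b`_i)).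
by rewrite rcompE rhom_ofE.
Qed.

Lemma regular_sub_power : exists j : rhom (regular_mod S) MR_power, injective j.
Proof.
pose j (s : regular_mod S) : MR_power := vsval (sstar s).
have j_lin : linear j by move=> k s t; rewrite /j anti_linear linearP.
have j_act (s : regular_mod S) t : j (ract s t) = ract (j s) t.
  exact: (congr1 val (antiM sstar s t)).
exists (rhom_of j_lin j_act) => s t; rewrite !rhom_ofE => /val_inj.
exact: sstar_inj.
Qed.

(** As [P] is projective, it embeds in [S], hence in a power of [M_R]; as it is
    injective, this embedding splits.  So a power of [M_R] maps onto [P] and
    then onto [L]. *)
Lemma cover_injective_functor (P L : rmodule S) :
  simple_mod L -> projective_cover P L -> injective_mod P ->
  nonzero (schur_functor L).
Proof.
move=> L_simple P_cover P_inj; have [[l l0] _] := L_simple.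
have reg_free : free_on 1 (1 : regular_mod S).
  split=> [|s|s]; rewrite /= /reg_ract ?mul1r //.
  by exists s; rewrite mul1r.
have [h h1] := free_on_hom reg_free (ract1 l).
have h_surj : surj h.
  by apply: (@simple_target_surj _ _ (regular_mod S) L h 1); rewrite ?h1.
have [g g_surj] := cover_surj P_cover (free_on_projective reg_free) h_surj.
have [P_proj [p [p_surj _]]] := P_cover.
have [i gi] := projective_split P_proj g_surj.
have [j j_inj] := regular_sub_power.
have ji_inj : injective (rcomp j i).
  by move=> x y; rewrite !rcompE => /j_inj /(can_inj gi).
have [r rE] := P_inj _ _ (rcomp j i) (rcomp g i) ji_inj.
have [x px] := p_surj l.
apply: (@MR_power_hom_functor L (rcomp p r) (rcomp j i x)).
by rewrite (rcompE p r) rE rcompE gi px.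
Qed.

End RegularSummand.

(** * Self-duality over a symmetric algebra *)

Section Symmetric.

Variables (K : fieldType) (AM : schur_pair K).
Local Notation A := (spA AM).
Local Notation M := (spM AM).
Local Notation S := (schur_alg AM).
Variables (kappa : rhom M (regular_mod A)) (m0 : M) (e : S).
Hypothesis kappa_m0 : kappa m0 = 1.
Hypothesis eE : forall x, sact e x = ract m0 (kappa x).
Variables (star : anti_involution A) (theta : riso M (dual_mod star M)).
Local Notation sstar := (schur_star theta).
Local Notation MR := (MR_mod theta).
Local Notation MR_dual := (dual_mod sstar MR).
Hypothesis e_star : schur_star theta e = e.
Hypothesis A_symmetric : symmetric_alg A.
Local Notation corner := (corner kappa m0).

(** The linear form whose pairing [frob (b a^* )] on [A] is the restriction of
    the pairing [theta] to the summand [A] of [M]. *)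
Definition frob (b : A) : K := theta m0 (ract m0 b).

Lemma frob_linear : linear (frob : A -> K^o).
Proof. by move=> k b c; rewrite /frob ract_linearr linearP. Qed.

Lemma theta_m0 a b : theta (ract m0 a) (ract m0 b) = frob (b * star a).
Proof. by rewrite theta_ract -ractM. Qed.

Lemma theta_e x y : theta (sact e x) y = theta x (sact e y).
Proof. by rewrite -{1}e_star theta_sstar. Qed.

(** The condition [e^* = e] says that the summand [A] is orthogonal to its
    complement in [M], so the pairing remains nondegenerate on [A]. *)
Lemma frob_nondegenerate b : (forall z, frob (b * z) = 0) -> b = 0.
Proof.
move=> b0; have m0b : ract m0 b = 0.
  apply: (theta_separates (theta := theta)) => x.
  have <- : sact e (ract m0 b) = ract m0 b by rewrite sact_ract (e_m0 kappa_m0).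
  by rewrite -theta_e eE theta_m0 b0.
by rewrite -[b]mul1r -kappa_m0 -[_ * b]/(ract (kappa m0) b) -rhomP m0b linear0.
Qed.

(** For a symmetrizing form, every linear form is [form c] for some [c], and
    nondegeneracy of [frob] makes this [c] invertible.  Hence the Nakayama
    automorphism of [frob] is conjugation by [c]. *)
Lemma frob_nakayama_inner :
  exists c d : A, [/\ c * d = 1, d * c = 1 &
    forall a z, frob (d * a * c * z) = frob (z * a)].
Proof.
have [form [form_linr form_linl form_sym]] := A_symmetric.
move=> form_nondeg form_assoc.
pose phi b : 'Hom(A, K^o) := linfun (form b : A -> K^o).
have phiE b x : phi b x = form b x.
  by apply: linfun_linearE => k y z; apply: form_linr.
have phi_lin : linear phi.
  move=> k x y; apply/lfunP => z.
  by rewrite add_lfunE scale_lfunE !phiE; apply: form_linl.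
have phi_inj : injective (linfun phi).
  apply/lker0P; rewrite -subv0; apply/subvP => x.
  rewrite memv_ker linfun_linearE // memv0 => /eqP x0.
  by apply/eqP/form_nondeg => y; rewrite -phiE x0 zero_lfunE.
have [c cE] := lfun_inj_surj phi_inj (esym (dim_functionals _))
  (linfun (frob : A -> K^o)).
have {}cE b : form c b = frob b.
  rewrite -phiE -(linfun_linearE phi_lin) cE linfun_linearE //.
  exact: frob_linear.
have mul_c_lin : linear ( *%R c : A -> A).
  by move=> k x y; rewrite mulrDr scalerAr.
have c_inj : injective (linfun ( *%R c : A -> A)).
  apply/lker0P; rewrite -subv0; apply/subvP => b.
  rewrite memv_ker linfun_linearE // memv0 => /eqP cb.
  apply/eqP/frob_nondegenerate => z.
  by rewrite -cE -form_assoc cb -phiE (linear_map0 phi_lin) zero_lfunE.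
have [d] := lfun_inj_surj c_inj erefl 1; rewrite linfun_linearE // => cd.
have dc : d * c = 1.
  by apply: c_inj; rewrite !linfun_linearE // mulrA cd mul1r mulr1.
exists c, d; split=> // a z.
by rewrite -!cE -!mulrA -form_assoc cd -form_assoc mul1r form_sym form_assoc.
Qed.

(** With the pairing [frob], the star of [corner y] is [corner x] exactly when
    [frob (y z) = frob (z x^* )] for all [z], which the previous lemma solves
    for [y]. *)
Lemma corner_twist x : exists u v y : A,
  [/\ u * v = 1, v * u = 1, y = u * star x * v & sstar (corner y) = corner x].
Proof.
have [c [d [cd dc nak]]] := frob_nakayama_inner.
exists d, c, (d * star x * c); split=> //.
apply: schur_ext => m; apply/subr0_eq/(bij_inj (riso_bij theta)).
rewrite linear0 linearB; apply/eqP; rewrite subr_eq0; apply/eqP/lfunP => n.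
rewrite /= theta_sstar !liftE // -!ractM.
have e_ract y : ract m0 y = sact e (ract m0 y).
  by rewrite sact_ract (e_m0 kappa_m0).
rewrite e_ract -theta_e eE theta_m0 -[_ * kappa n * _]mulrA nak.
by rewrite [in RHS]e_ract theta_e eE theta_m0 antiM mulrA.
Qed.

Lemma acts_conj (D : rmodule A) (u v x : A) : u * v = 1 -> v * u = 1 ->
  acts D (u * x * v) <-> acts D x.
Proof.
move=> uv vu; split=> [[t txv] | [t tx]].
  exists (ract t u); apply: contra txv => /eqP txv.
  by rewrite !ractM txv ract0l.
exists (ract t v); rewrite -ractM !mulrA vu mul1r.
apply: contra tx => /eqP tx.
by rewrite -[x]mulr1 -vu mulrA ractM tx ract0l.
Qed.

Lemma acts_self_dual (D : rmodule A) x :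
  isomorphic (dual_mod star D) D -> acts D x -> acts D (star x).
Proof.
move=> /isomorphic_sym[f] [t tx].
have /lfunPn[d] : f (ract t x) != 0.
  apply: contra tx => /eqP tx; apply/eqP/(bij_inj (riso_bij f)).
  by rewrite tx linear0.
rewrite rhomP dual_ractE zero_lfunE => fd; exists d.
by apply: contra fd => /eqP->; rewrite linear0.
Qed.

(** Passing to a dual replaces the action of [x] by that of [x^*], and
    conjugation does not change whether an element acts as zero. *)
Lemma acts_twist (D : rmodule A) x : isomorphic (dual_mod star D) D ->
  exists2 y, sstar (corner y) = corner x & acts D x <-> acts D y.
Proof.
move=> D_dual; have [u [v [y [uv vu yE s_y]]]] := corner_twist x.
exists y; rewrite // yE; have [to_x of_x] := acts_conj D (star x) uv vu.
split=> [/(acts_self_dual D_dual)/of_x // | /to_x/(acts_self_dual D_dual)].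
by rewrite anti_invK.
Qed.

(** The dual of [P] is projective, so a nonzero homomorphism from it to [L]
    yields a surjection onto [P], which is bijective by dimension.  The
    homomorphism is the restriction of one from the dual of [M_R]; it is nonzero
    because elements of [A] related by the stars act on [L (x) M] as zero or
    nonzero together. *)
Lemma cover_self_dual (P L : rmodule S) :
  simple_mod L -> projective_cover P L -> nonzero (schur_functor L) ->
  isomorphic (dual_mod star (schur_functor L)) (schur_functor L) ->
  isomorphic P (dual_mod sstar P).
Proof.
move=> L_simple P_cover L_nz D_dual.
have m0_free := MR_free_on kappa_m0 eE e_star.
have dual_free := MR_dual_free_on kappa_m0 eE e_star.
have [i [p ip]] := cover_retract_MR kappa_m0 eE e_star L_simple P_cover L_nz.
have [[l0 l0_neq0] _] := L_simple.
have [_ [k [k_surj _]]] := P_cover.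
have [a aE] : exists a, i (p m0) = ract m0 a.
  exists (kappa (i (p m0))); rewrite -eE.
  have [m0e _ _] := m0_free.
  by rewrite -{1}m0e !rhomP MR_ractE e_star.
(* The elements of S commute with a, so i p is right multiplication by a. *)
have ipE (x : M) : i (p x) = ract x a.
  have [_ m0_gen _] := m0_free; have [s ->] := m0_gen x.
  by rewrite !rhomP aE !MR_ractE sact_ract.
(* Otherwise every homomorphism from P to L would vanish on p m0. *)
have D_a : acts (schur_functor L) a.
  have [y s_y D_y] := acts_twist a D_dual; apply/D_y.
  apply/(acts_functor kappa_m0); exists (rcomp k p m0).
  rewrite -rhomP MR_ractE s_y (corner_m0 kappa_m0) -aE.
  rewrite rcompE ip -rcompE; have [q kq] := k_surj l0.
  by apply: (free_on_hom_neq0 m0_free (y := i q)); rewrite rcompE ip kq.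
(* Three stars, because S acts on the generator of the dual of M_R through
   the third power of the star. *)
have [y1 s1 D1] := acts_twist (star a) D_dual.
have [y2 s2 D2] := acts_twist y1 D_dual.
have [y3 s3 D3] := acts_twist y2 D_dual.
have [l ly] : acts L (corner y3).
  apply/(acts_functor kappa_m0)/D3/D2/D1.
  exact: acts_self_dual.
have [|h hE] := @free_on_hom _ _ _ _ _ dual_free L (ract l e).
  by rewrite -ractM (e_idem kappa_m0 eE).
have hp_neq0 : rcomp h (dual_hom sstar p) (dual_hom sstar i (theta m0)) != 0.
  rewrite rcompE (_ : dual_hom _ _ _ = ract (theta m0 : MR_dual) (corner y3)).
    by rewrite rhomP hE -ractM e_corner.
  rewrite MR_dual_ract s3 s2 s1 (corner_m0 kappa_m0).
  by apply/lfunP => x; rewrite !dual_homE ipE theta_ract (anti_invK star).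
have hp_surj := simple_target_surj L_simple hp_neq0.
have dualP_proj : projective_mod (dual_mod sstar P).
  apply: (@retract_projective _ _ _ MR_dual).
    by apply: dual_retract; exists i, p.
  exact: free_on_projective dual_free.
have [g g_surj] := cover_surj P_cover dualP_proj hp_surj.
apply: isomorphic_sym; constructor; exists g.
exact/(lfun_surj_bij g_surj)/dim_functionals.
Qed.

End Symmetric.

(** * The equivalences *)

(** The idempotent [e] factors as [M -> A -> M], the second map being
    [a |-> m0 a] with [m0] the image of the unit of [A]. *)
Lemma regular_summand_projection (K : fieldType) (AM : schur_pair K)
    (U V : rsub (spM AM)) (e : schur_alg AM) :
  internal_sum U V -> isomorphic (regular_mod (spA AM)) (submodule U) ->
  (forall u v, u \in U -> v \in V -> sact e (u + v) = u) ->
  exists (kappa : rhom (spM AM) (regular_mod (spA AM))) (m0 : spM AM),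
    kappa m0 = 1 /\ forall x, sact e x = ract m0 (kappa x).
Proof.
move=> UV [j] e_proj; have [p [pU pV]] := summand_proj UV.
have [g [jK Kj]] := rhom_inverse (riso_bij j).
have p_val u : p (vsval u) = u by apply/val_inj/pU/subvsP.
have jE a : vsval (j a) = ract (vsval (j 1)) a.
  by rewrite -[a in LHS]mul1r [j _](rhomP j 1 a).
exists (rcomp g p), (vsval (j 1)); rewrite rcompE p_val jK.
split=> // x; rewrite rcompE -jE Kj.
have [UV_full _] := UV; have : x \in (U + V)%VS by rewrite UV_full memvf.
case/memv_addP => u uU [v vV ->]; rewrite e_proj // linearD /=.
by rewrite (pV v) // addr0 pU.
Qed.

Theorem theorem2p22 (K : fieldType) (AM : schur_pair K)
    (A_split : split_alg (spA AM)) (S_split : split_alg (schur_alg AM))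
    (star : anti_involution (spA AM))
    (theta : riso (spM AM) (dual_mod star (spM AM)))
    (A_symmetric : symmetric_alg (spA AM))
    (U V : rsub (spM AM)) (UV : internal_sum U V)
    (UA : isomorphic (regular_mod (spA AM)) (submodule U))
    (e : schur_alg AM)
    (e_proj : forall u v : spM AM, u \in U -> v \in V -> sact e (u + v) = u)
    (e_star : schur_star theta e = e)
    (I : Type) (L : I -> rmodule (schur_alg AM)) (L_simples : complete_simples L)
    (P : I -> rmodule (schur_alg AM))
    (P_cover : forall lambda, projective_cover (P lambda) (L lambda))
    (D := fun lambda => schur_functor (L lambda))
    (calK := fun lambda => nonzero (D lambda))
    (D_self_dual : forall mu, calK mu -> isomorphic (dual_mod star (D mu)) (D mu))
    (lambda : I) :
  [<-> calK lambda;
       nonzero (D lambda);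
       isom_submodule (L lambda) (MR_mod theta);
       isom_summand (P lambda) (MR_mod theta);
       projective_mod (P lambda) /\ injective_mod (P lambda);
       isomorphic (P lambda) (dual_mod (schur_star theta) (P lambda))].
Proof.
have [kappa [m0 [kappa_m0 eE]]] := regular_summand_projection UV UA e_proj.
have [L_simple _ _] := L_simples.
have cover_retract : calK lambda -> retract (P lambda) (MR_mod theta).
  exact: (cover_retract_MR kappa_m0 eE e_star).
have injective_calK : injective_mod (P lambda) -> calK lambda.
  exact: (cover_injective_functor kappa_m0 eE e_star).
have sub_MR := simple_sub_MR theta (L_simple lambda).
tfae.
- by [].
- by case: sub_MR.
- by case: sub_MR => _ of_sub /of_sub/cover_retract/retract_summand.
- move=> /summand_retract PM; split; first by have [] := P_cover lambda.
  exact: retract_injective PM (MR_injective kappa_m0 eE e_star).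
- move=> [_ /injective_calK L_nz].
  apply: (cover_self_dual kappa_m0 eE e_star A_symmetric _ _ L_nz) => //.
  exact: D_self_dual.
- move=> /isomorphic_retract P_dual; apply: injective_calK.
  apply: (retract_injective P_dual); apply: dual_projective_injective.
    exact: sstar_inj.
  by have [] := P_cover lambda.
Qed.
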